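(* Let $\langle\gamma_n\colon n<\omega\rangle$ be a strictly increasing sequence of infinite cardinals with supremum $\gamma$ and let $\mathcal D$ be a function with domain $\{(0,0)\}\cup\{(n,\alpha)\colon 0<n<\omega,\ \alpha<\gamma_{n-1}\}$ such that $\mathcal D(0,0)$ is a $\gamma_0$-complete ultrafilter on $\gamma_0$, each $\mathcal D(n,\alpha)$ is a $\gamma_n$-complete ultrafilter on $\gamma_n$, and $\mathcal D(n,\alpha)\neq\mathcal D(n,\beta)$ for $\alpha\neq\beta$. Let $\varphi$ be a sentence of the forcing language of $\mathbb P_{\mathcal D}$ and let $s$ be a finite strictly increasing sequence of ordinals with $|s|>0$ and $s(i)<\gamma_i$ for all $i<|s|$. Then there is a $\mathcal D$-choice function $F$ such that $(s,F)$ decides $\varphi$.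
   Context: A $\mathcal D$-choice function is a function $F$ with $\mathrm{dom}(F)=\mathrm{dom}(\mathcal D)$ and $F(x)\in\mathcal D(x)$. The forcing $\mathbb P_{\mathcal D}$ consists of pairs $(s,F)$ with $s$ as in the claim and $F$ a $\mathcal D$-choice function; $(s',F')$ is stronger than $(s,F)$ iff $|s|\le|s'|$, $s'\restriction|s|=s$, $F'(x)\subseteq F(x)$ for all $x\in\mathrm{dom}(\mathcal D)$, and $s'(i)\in F(i,s'(i-1))$ for $|s|\le i<|s'|$. A condition decides $\varphi$ if it forces $\varphi$ or forces $\neg\varphi$. *)

(* Defs.v *)
From HB Require Import structures.
From mathcomp Require Import all_boot all_order.
From mathcomp Require Import boolp classical_sets functions cardinality filter.

Set Implicit Arguments.
Unset Strict Implicit.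
Unset Printing Implicit Defensive.

Import Order.TTheory.
Local Open Scope classical_set_scope.
Local Open Scope card_scope.
Local Open Scope order_scope.

(* Forcing over a preordered type (P, le); le q p reads "q is stronger than p". *)
Section Forcing.
Context (P : Type) (le : P -> P -> Prop).

(* The P-names of the ground universe: Name A f c is { (f i, c i) | i : A }. *)
Inductive name : Type := Name (A : Type) (f : A -> name) (c : A -> P).

Definition dense_below (A : P -> Prop) (p : P) : Prop :=
  forall q, le q p -> exists r, le r q /\ A r.

(* p forces sigma = tau: for every (pi, c) in sigma, each q below both p and c
   forces pi to be in tau, and symmetrically. *)
Fixpoint forces_eq (sigma tau : name) (p : P) {struct sigma} : Prop :=
  match sigma, tau with
  | Name A f c, Name B g d =>
      (forall i q, le q p -> le q (c i) ->
         dense_below (fun r => exists j, le r (d j) /\ forces_eq (f i) (g j) r) q)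
   /\ (forall j q, le q p -> le q (d j) ->
         dense_below (fun r => exists i, le r (c i) /\ forces_eq (f i) (g j) r) q)
  end.

Definition forces_mem (sigma tau : name) (p : P) : Prop :=
  let: Name B g d := tau in
  dense_below (fun r => exists j, le r (d j) /\ forces_eq sigma (g j) r) p.

(* First-order formulas over { =, \in } with P-names as constants and with free
   variables in X; the variable bound by FAll is None : option X. *)
Inductive formula (X : Type) : Type :=
  | FEq of X + name & X + name
  | FMem of X + name & X + name
  | FNeg of formula X
  | FAnd of formula X & formula X
  | FAll of formula (option X).

Definition sentence := formula void.

Definition eval_term X (v : X -> name) (t : X + name) : name :=
  match t with inl x => v x | inr tau => tau end.

Fixpoint forces_at X (phi : formula X) (v : X -> name) (p : P) : Prop :=
  match phi with
  | FEq t u => forces_eq (eval_term v t) (eval_term v u) p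
  | FMem t u => forces_mem (eval_term v t) (eval_term v u) p
  | FNeg psi => forall q, le q p -> ~ forces_at psi v q
  | FAnd psi chi => forces_at psi v p /\ forces_at chi v p
  | FAll psi => forall tau : name, forces_at psi (oapp v tau) p
  end.

Definition forces (p : P) (phi : sentence) : Prop :=
  forces_at phi (of_void name) p.

Definition decides (p : P) (phi : sentence) : Prop :=
  forces p phi \/ forces p (FNeg phi).

End Forcing.

(* Ordinals are the elements of a well-ordered type W, an ordinal kappa being
   identified with its initial segment. *)
Section Ordinals.
Context {d : Order.disp_t} {W : orderType d}.

Definition below (kappa : W) : Type := {x : W | x < kappa}.

Definition infinite_cardinal (kappa : W) : Prop :=
  infinite_set [set: below kappa] /\
  (forall alpha, alpha < kappa -> ~ ([set: below kappa] #<= [set: below alpha])).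

Definition card_lt T U (A : set T) (B : set U) : Prop :=
  (A #<= B) /\ ~ (B #<= A).

Definition complete_filter (kappa : W) T (U : set_system T) : Prop :=
  forall S : set (set T), card_lt S [set: below kappa] -> S `<=` U ->
    U (\bigcap_(A in S) A).

End Ordinals.

Section TreePrikry.
Context {d : Order.disp_t} {W : orderType d} (gamma : nat -> W).

(* The domain of D: Idx0 is (0, 0) and IdxS n alpha is (n + 1, alpha), where
   alpha < gamma_n. *)
Inductive idx : Type := Idx0 | IdxS (n : nat) (alpha : below (gamma n)).

Definition level (x : idx) : nat :=
  match x with Idx0 => 0%N | IdxS n _ => n.+1 end.

Context (D : forall x : idx, set_system (below (gamma (level x)))).

Definition choice_function (F : forall x, set (below (gamma (level x)))) : Prop :=
  forall x, @D x (F x).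

(* The default value gamma 0 of nth is never reached. *)
Definition is_stem (s : seq W) : Prop :=
  [/\ (0 < size s)%N, sorted <%O s &
      forall i, (i < size s)%N -> nth (gamma 0%N) s i < gamma i].

Record condition : Type := Condition {
  stem : seq W;
  side : forall x, set (below (gamma (level x)));
  stemP : is_stem stem;
  sideP : choice_function side
}.

(* In the last clause alpha is s'(n) and beta is s'(n + 1), so that it says
   s'(i) \in F(i, s'(i - 1)) for i = n + 1; since stems are nonempty, all i with
   |s| <= i < |s'| are of this form. *)
Definition stronger (q p : condition) : Prop :=
  [/\ (size (stem p) <= size (stem q))%N,
      take (size (stem p)) (stem q) = stem p,
      forall x, @side q x `<=` @side p x &
      forall n (alpha : below (gamma n)) (beta : below (gamma n.+1)),
        (size (stem p) <= n.+1 < size (stem q))%N ->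
        nth (gamma 0%N) (stem q) n = val alpha ->
        nth (gamma 0%N) (stem q) n.+1 = val beta ->
        @side p (IdxS alpha) beta].

End TreePrikry.

(* Main.v *)
Require Import Defs.
From mathcomp Require Import all_boot all_order.
From mathcomp Require Import boolp classical_sets functions cardinality filter.

Set Implicit Arguments.
Unset Strict Implicit.
Unset Printing Implicit Defensive.

Local Open Scope classical_set_scope.
Local Open Scope order_scope.

(** If (s, F) forces phi for no F, then fusing witnesses over all stems yields a
    single F such that no extension of (s, F) has a stem which some side
    function makes force phi; hence (s, F) forces the negation of phi. The
    fusion intersects, at the node (n + 1, alpha), one measure-one set for each
    stem of length at most n + 1; gamma_(n+1)-completeness allows it, by
    intersecting over one coordinate of the stem at a time. *)

(** * Monotonicity and density of the forcing relation *)

Section ForcingRelation.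
Context (P : Type) (le : P -> P -> Prop).
Context (le_refl : forall p, le p p).
Context (le_trans : forall q p r, le r q -> le q p -> le r p).

Lemma forces_eq_mono sigma tau p q :
  le q p -> forces_eq le sigma tau p -> forces_eq le sigma tau q.
Proof.
move=> qp; case: sigma tau => A f c [B g d] /= [H1 H2].
by split=> i r rq; [apply: H1|apply: H2]; exact: le_trans rq qp.
Qed.

Lemma dense_below_mono (A : P -> Prop) p q :
  le q p -> dense_below le A p -> dense_below le A q.
Proof. by move=> qp Ap r rq; apply: Ap; exact: le_trans rq qp. Qed.

Lemma dense_below_idem (A : P -> Prop) p :
  dense_below le (dense_below le A) p -> dense_below le A p.
Proof.
move=> Ap q /Ap[r [rq]] /(_ r (le_refl r))[r' [r'r Ar']].
by exists r'; split=> //; exact: le_trans r'r rq.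
Qed.

(** Both clauses of [forces_eq] are themselves density statements, so splitting the names once
    suffices, without induction. *)
Lemma forces_eq_dense sigma tau p :
  dense_below le (forces_eq le sigma tau) p -> forces_eq le sigma tau p.
Proof.
case: sigma tau => A f c [B g d] Hp /=.
split=> i q qp qi; apply: dense_below_idem => q' q'q;
  have [r [rq' Hr]] := Hp q' (le_trans q'q qp); case: Hr => H1 H2;
  exists r; split=> //.
- exact: H1 (le_trans (le_trans rq' q'q) qi).
- exact: H2 (le_trans (le_trans rq' q'q) qi).
Qed.

(* [forces_at] lives at [X : Set], which the induction principle generated with
   [formula] (at [X : Type]) does not cover. *)
Lemma formula_Set_ind (Q : forall X : Set, formula P X -> Prop) :
  (forall (X : Set) t u, Q X (FEq t u)) ->
  (forall (X : Set) t u, Q X (FMem t u)) ->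
  (forall (X : Set) psi, Q X psi -> Q X (FNeg psi)) ->
  (forall (X : Set) psi chi, Q X psi -> Q X chi -> Q X (FAnd psi chi)) ->
  (forall (X : Set) psi, Q (option X) psi -> Q X (FAll psi)) ->
  forall (X : Set) psi, Q X psi.
Proof.
move=> QEq QMem QNeg QAnd QAll; fix IH 2 => X.
by case=> [t u|t u|psi|psi chi|psi];
  [exact: QEq|exact: QMem|apply: QNeg|apply: QAnd|apply: QAll]; exact: IH.
Qed.

Lemma forces_at_mono (X : Set) (psi : formula P X) v p q :
  le q p -> forces_at le psi v p -> forces_at le psi v q.
Proof.
elim/formula_Set_ind: X / psi v p q =>
  [X t u|X t u|X psi _|X psi chi IH1 IH2|X psi IH] v p q qp /=.
- exact: forces_eq_mono.
- by rewrite /forces_mem; case: eval_term => B g d; exact: dense_below_mono.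
- by move=> H r rq; apply: H; exact: le_trans rq qp.
- by move=> [H1 H2]; split; [exact: IH1 qp H1|exact: IH2 qp H2].
- by move=> H tau; exact: IH qp (H tau).
Qed.

(** Atomic formulas are density statements, and conjunction and quantification commute with density.
    At a negation, a [q] forcing [psi] would pass it on to some [r] below [q] that forces the
    negation. *)
Lemma forces_at_dense (X : Set) (psi : formula P X) v p :
  dense_below le (forces_at le psi v) p -> forces_at le psi v p.
Proof.
elim/formula_Set_ind: X / psi v p =>
  [X t u|X t u|X psi _|X psi chi IH1 IH2|X psi IH] v p /=.
- exact: forces_eq_dense.
- by rewrite /forces_mem; case: eval_term => B g d; exact: dense_below_idem.
- move=> H q qp psiq; have [r [rq Hr]] := H q qp.
  exact: Hr (le_refl r) (forces_at_mono rq psiq).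
- by move=> H; split; [apply: IH1|apply: IH2] => q /H[r [rq []]]; exists r.
- by move=> H tau; apply: IH => q /H[r [rq Hr]]; exists r.
Qed.

End ForcingRelation.

(** * Small intersections in complete filters *)

Section Completeness.
Context {d : Order.disp_t} {W : orderType d}.

Lemma card_le_below (kappa lambda : W) : kappa <= lambda ->
  ([set: below kappa] #<= [set: below lambda])%card.
Proof.
move=> kl.
have val_inj_card (x : W) : (val @` [set: below x] #= [set: below x])%card.
  by apply: inj_card_eq => u v _ _; exact: val_inj.
have sub : val @` [set: below kappa] `<=` val @` [set: below lambda].
  move=> _ [[x xk] _ <-].
  by exists (exist _ x (Order.POrderTheory.lt_le_trans xk kl)).
have := subset_card_le sub.
by rewrite (card_le_eql (val_inj_card _)) (card_le_eqr (val_inj_card _)).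
Qed.

(** Since [lambda] is a cardinal, [below kappa], and with it the range of [G], is strictly smaller
    than [below lambda]. *)
Lemma complete_filter_bigcap (kappa lambda : W) T (U : set_system T)
    (G : below kappa -> set T) :
  infinite_cardinal lambda -> kappa < lambda -> complete_filter lambda U ->
  (forall a, U (G a)) -> U (\bigcap_a G a).
Proof.
move=> [_ cardl] kl Uc UG.
have -> : \bigcap_a G a = \bigcap_(A in range G) A by rewrite bigcap_image.
have lt_range : (range G #<= [set: below kappa])%card by exact: card_image_le.
apply: Uc => [|_ [a _ <-]//]; split.
  apply: card_le_trans lt_range _.
  exact/card_le_below/Order.POrderTheory.ltW.
by move=> /card_le_trans/(_ lt_range); exact: cardl.
Qed.

(* Intersecting one coordinate at a time avoids the cardinal arithmetic of
   finite sequences. *)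
Lemma complete_filter_bigcap_seq (gamma : nat -> W) (x0 lambda : W) T
    (U : set_system T) (k : nat) (G : seq W -> set T) :
  Filter U -> infinite_cardinal lambda -> complete_filter lambda U ->
  (forall i, (i < k)%N -> gamma i < lambda) ->
  (forall t, U (G t)) ->
  U (\bigcap_(t in [set t | (size t <= k)%N /\
        forall i, (i < size t)%N -> nth x0 t i < gamma i]) G t).
Proof.
move=> UF lambdaP Uc; elim: k G => [|k IH] G gl UG.
  by apply: filterS (UG [::]) => x Gx [_|a t []].
(* [G' t] absorbs the one-entry extensions of [t], so a sequence of length [k.+1] is reached through
   its initial segment of length [k]. The [else] branch is a dummy value. *)
pose G' t := if (size t <= k)%N
  then G t `&` \bigcap_(a : below (gamma (size t))) G (rcons t (val a))
  else G t.
have /IH : forall t, U (G' t).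
  move=> t; rewrite /G'; case: ifP => // tk; apply: filterI => //.
  exact: complete_filter_bigcap lambdaP (gl _ tk) Uc _.
move=> /(_ (fun i ik => gl i (ltnW ik))); apply: filterS => x Gx t [].
case/lastP: t => [|u a] /=; first by move=> _ _; have [] := Gx [::] (conj _ _).
rewrite size_rcons ltnS => uk ub.
have ak : a < gamma (size u).
  by have := ub (size u) (ltnSn _); rewrite nth_rcons ltnn eqxx.
have ub' i : (i < size u)%N -> nth x0 u i < gamma i.
  by move=> iu; have := ub i (ltnW iu); rewrite nth_rcons iu.
have := Gx u (conj uk ub'); rewrite /G' uk => -[_ /(_ (exist _ a ak))].
exact.
Qed.

End Completeness.

(** * The order of the tree Prikry forcing and common extensions *)

Section TreePrikry.
Context {d : Order.disp_t} {W : orderType d} (gamma : nat -> W).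
Context (D : forall x : idx gamma, set_system (below (gamma (level x)))).
Context (gamma_card : forall n, infinite_cardinal (gamma n)).
Context (gamma_incr : forall m n : nat, (m < n)%N -> gamma m < gamma n).
Context (D_ultra : forall x, UltraFilter (@D x)).
Context (D_complete : forall x, complete_filter (gamma (level x)) (@D x)).

Local Notation le := (@stronger d W gamma D).
Local Notation "t `_ i" := (nth (gamma 0%N) t i).

Definition follows (F : forall x : idx gamma, set (below (gamma (level x))))
    (k : nat) (t : seq W) : Prop :=
  forall n (alpha : below (gamma n)) (beta : below (gamma n.+1)),
    (k <= n.+1 < size t)%N -> t`_n = val alpha -> t`_n.+1 = val beta ->
    F (IdxS alpha) beta.

Lemma stronger_refl p : le p p.
Proof.
split=> //; [by rewrite take_size|by move=> x y|].
by move=> n alpha beta /andP[pn /(leq_ltn_trans pn)]; rewrite ltnn.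
Qed.

Lemma stronger_trans q p r : le r q -> le q p -> le r p.
Proof.
move=> [rq1 rq2 rq3 rq4] [qp1 qp2 qp3 qp4]; split.
- exact: leq_trans qp1 rq1.
- by rewrite -[RHS]qp2 -[in RHS]rq2 take_takel.
- by move=> x y /rq3/qp3.
- move=> n alpha beta /andP[pn nr] ra rb.
  (* Entries of [stem r] past [stem q] obey [side q], hence [side p]; the earlier ones are entries
     of [stem q]. *)
  have [qn|nq] := leqP (size (stem q)) n.+1.
    by apply: qp3; apply: (rq4 _ _ _ _ ra rb); rewrite qn.
  by apply: qp4; rewrite ?pn// -rq2 nth_take// ltnW.
Qed.

Lemma choice_functionI F G :
  choice_function D F -> choice_function D G ->
  choice_function D (fun x => F x `&` G x).
Proof. by move=> DF DG x; apply: filterI. Qed.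

Lemma is_stem_take k t :
  (0 < k)%N -> is_stem gamma t -> is_stem gamma (take k t).
Proof.
move=> k0 [t0 tsort tlt]; split.
- by rewrite size_take; case: ifP.
- exact: take_sorted.
- move=> i; rewrite size_take_min leq_min => /andP[ik it].
  by rewrite nth_take ?tlt.
Qed.

(** Quantifying over conditions instead of sides makes sense for any sequence [t]; that [t] is a
    stem is then part of what [can_force] yields. *)
Definition can_force (psi : sentence (condition D)) (t : seq W) : Prop :=
  exists2 p, stem p = t & forces le p psi.

Lemma can_force_condition psi s (s_stem : is_stem gamma s) : can_force psi s ->
  exists F (F_choice : choice_function D F),
    forces le (Condition s_stem F_choice) psi.
Proof.
move=> [[t F t_stem F_choice] /= ts pF]; case: _ / ts s_stem => s_stem.
by exists F, F_choice; rewrite (Prop_irrelevance s_stem t_stem).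
Qed.

(** Keeping the stem of [q] and intersecting the two sides gives a condition below both, even if
    [side q] does not refine [side p]. *)
Lemma forces_common_extension psi p q :
  forces le p psi -> (size (stem p) <= size (stem q))%N ->
  take (size (stem p)) (stem q) = stem p ->
  follows (side p) (size (stem p)) (stem q) ->
  exists2 r, le r q & forces le r psi.
Proof.
move=> ppsi pq takeq qp.
pose r := Condition (stemP q) (choice_functionI (sideP q) (sideP p)).
have rp : le r p by split=> // x y [].
exists r; last exact: forces_at_mono stronger_trans _ _ _ _ _ rp ppsi.
split=> //; [by rewrite take_size|by move=> x y []|].
by move=> n alpha beta /andP[pn /(leq_ltn_trans pn)]; rewrite ltnn.
Qed.

(** The fusion needs one side for every sequence at once, picked by choice; where [can_force] fails,
    full sets serve as dummies. *)
Lemma can_force_witness psi :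
  exists w : seq W -> forall x, set (below (gamma (level x))),
    (forall t, choice_function D (w t)) /\
    (forall t, can_force psi t ->
       exists p, [/\ stem p = t, side p = w t & forces le p psi]).
Proof.
suff /choice[w wP] : forall t, exists F, choice_function D F /\
    (can_force psi t ->
       exists p, [/\ stem p = t, side p = F & forces le p psi]).
  by exists w; split=> t; have [] := wP t.
move=> t; have [[p pt ppsi]|nt] := pselect (can_force psi t).
  by exists (side p); split=> [|_]; [exact: sideP|exists p].
by exists (fun=> setT); split=> // x; exact: filterT.
Qed.

(** * Ultrafilter dichotomy and fusion of sides *)

Definition large_side (x : idx gamma) (A : set (below (gamma (level x)))) :=
  if `[< @D x A >] then A else ~` A.

Lemma large_sideP x A : @D x (@large_side x A).
Proof.
rewrite /large_side; case: asboolP => // nA.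
by have [] := in_ultra_setVsetC A (D_ultra x).
Qed.

(** The side at a node of level [n.+1] is only consulted for the entry of index [n.+1], so stems
    longer than [n.+1] may be ignored there. The entries of the others are bounded by some [gamma i]
    with [i < n.+1], within reach of completeness. *)
Lemma fusion
    (H : seq W -> forall x : idx gamma, set (below (gamma (level x)))) :
  (forall t, choice_function D (H t)) ->
  exists2 F, choice_function D F &
    forall t n (alpha : below (gamma n)), is_stem gamma t ->
      (size t <= n.+1)%N -> F (IdxS alpha) `<=` H t (IdxS alpha).
Proof.
move=> DH.
exists (fun x => \bigcap_(t in [set t | (size t <= level x)%N /\
    forall i, (i < size t)%N -> t`_i < gamma i]) H t x).
  move=> x; apply: complete_filter_bigcap_seq (@D_complete x) _ _ => //.
  - by move=> i; exact: gamma_incr.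
  - by move=> t; exact: DH.
by move=> t n alpha [_ _ tlt] tn y; apply.
Qed.

(** * Passing between a stem and its one-entry extensions *)

Lemma stem_nth t i : is_stem gamma t -> (i < size t)%N ->
  exists a : below (gamma i), t`_i = val a.
Proof.
move=> [_ _ tlt] it.
by exists (exist (fun x => is_true (x < gamma i)) _ (tlt i it)).
Qed.

(** An element of a side need not exceed [alpha], so appending it could break monotonicity;
    [can_force] certifies that the longer sequence is a stem. *)
Lemma longer_extension psi p n (alpha : below (gamma n)) :
  size (stem p) = n.+1 -> (stem p)`_n = val alpha ->
  (forall beta : below (gamma n.+1), @side _ _ _ _ p (IdxS alpha) beta ->
     can_force psi (rcons (stem p) (val beta))) ->
  exists2 q, le q p & size (stem q) = n.+2.
Proof.
move=> pn pa pb.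
have [beta pbeta] := filter_ex (sideP p (IdxS alpha)).
have [q qs _] := pb _ pbeta.
exists (Condition (stemP q) (sideP p)); last by rewrite /= qs size_rcons pn.
split=> /=; rewrite ?qs ?size_rcons //.
- by rewrite -cats1 take_size_cat.
- by move=> x y.
- move=> m alpha' beta'; rewrite pn !ltnS => /anti_leq nm.
  subst m; rewrite nth_rcons pn ltnSn pa nth_rcons pn ltnn eqxx.
  by move=> /val_inj <- /val_inj <-.
Qed.

(** By density it is enough to find, below any extension, a condition forcing [psi]: the entry
    following [t] selects a successor that can force [psi], and its witness is compatible with the
    extension because [F] refines [w]. *)
Lemma forces_of_successors psi
    (w : seq W -> forall x, set (below (gamma (level x)))) F
    (F_choice : choice_function D F) t (t_stem : is_stem gamma t) n
    (alpha : below (gamma n)) :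
  (forall u, can_force psi u ->
     exists p, [/\ stem p = u, side p = w u & forces le p psi]) ->
  (forall u m (a : below (gamma m)), is_stem gamma u -> (size u <= m.+1)%N ->
     F (IdxS a) `<=` w u (IdxS a)) ->
  size t = n.+1 -> t`_n = val alpha ->
  (forall beta, F (IdxS alpha) beta -> can_force psi (rcons t (val beta))) ->
  forces le (Condition t_stem F_choice) psi.
Proof.
move=> wP Fw tn ta succ.
apply: (forces_at_dense stronger_refl stronger_trans) => q qt.
have [qt1 qt2 qt3 _] := qt; rewrite /= tn in qt1 qt2.
(* The stem of [q] may still be [t]; it must be lengthened before a successor of [t] can be read
   off. *)
have [q' q'q q'n] : exists2 q', le q' q & (n.+1 < size (stem q'))%N.
  have [nq|qn] := ltnP n.+1 (size (stem q)).
    by exists q => //; exact: stronger_refl.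
  have qE : stem q = t by rewrite -qt2 take_oversize.
  have [|||q' q'q q'n] := @longer_extension psi q n alpha.
  - by rewrite qE.
  - by rewrite qE.
  - by move=> beta /qt3 Fbeta; rewrite qE; exact: succ.
  - by exists q'; rewrite // q'n.
have [/= q't1 q't2 _ q't4] := stronger_trans q'q qt.
rewrite tn in q't1 q't2 q't4.
have [beta betaE] := stem_nth (stemP q') q'n.
have q'nE : (stem q')`_n = val alpha by rewrite -ta -q't2 nth_take.
have [p [pE pw ppsi]] : exists p,
    [/\ stem p = take n.+2 (stem q'), side p = w (stem p) & forces le p psi].
  have [|p [pE pw ppsi]] := wP (rcons t (val beta)).
    by apply: succ; apply: q't4 q'nE betaE; rewrite leqnn.
  by exists p; rewrite (take_nth (gamma 0%N)) // q't2 betaE pE.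
have pn : size (stem p) = n.+2 by rewrite pE size_takel.
have [|||r rq' rpsi] := forces_common_extension (q := q') ppsi.
- by rewrite pn.
- by rewrite pn pE.
(* The remaining entries of [stem q'] are tested at levels at least [size (stem p)], where [F]
   refines [w (stem p)]. *)
- move=> m a b; rewrite pn => /andP[nm mq'] ma mb.
  rewrite pw; apply: Fw; [exact: stemP|by rewrite pn|].
  by apply: q't4 ma mb; rewrite mq' (ltnW nm).
- by exists r; split=> //; exact: stronger_trans rq' q'q.
Qed.

(** Inability to force [psi] propagates from [s] along the stem of any extension of [(s, F)], one
    entry at a time, so no extension forces [psi]. *)
Lemma can_force_or_forces_neg psi s (s_stem : is_stem gamma s) :
  ~ can_force psi s -> exists F (F_choice : choice_function D F),
    forces le (Condition s_stem F_choice) (FNeg psi).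
Proof.
move=> nforce; have [w [w_choice wP]] := can_force_witness psi.
pose good t (x : idx gamma) := [set beta : below (gamma (level x)) |
                   can_force psi (rcons t (val beta))].
(* The first factor makes witnesses compatible with [F]; the second makes the successors of [t]
   allowed by [F] all good or all bad. *)
pose H t (x : idx gamma) := w t x `&` @large_side x (good t x).
have [|F F_choice FH] := fusion (H := H).
  by move=> t; apply: choice_functionI => // x; exact: large_sideP.
exists F, F_choice => q [/= sq1 sq2 _ sq4] qpsi.
suff /(_ (size (stem q))) : forall k, (size s <= k <= size (stem q))%N ->
    ~ can_force psi (take k (stem q)).
  by rewrite sq1 leqnn take_size => /(_ isT); apply; exists q.
elim=> [|k IH]; first by have [+ _ _] := s_stem; case: size.
rewrite leq_eqVlt ltnS => /andP[/predU1P[<-|sk] kq]; first by rewrite sq2.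
have {IH} nk := IH (introT andP (conj sk (ltnW kq))).
have [n kE] : exists n, k = n.+1.
  have [s0 _ _] := s_stem; exists k.-1.
  by rewrite (ltn_predK (leq_trans s0 sk)).
subst k; have [alpha alphaE] := stem_nth (stemP q) (ltnW kq).
have [beta betaE] := stem_nth (stemP q) kq.
have Fbeta : F (IdxS alpha) beta by apply: sq4 alphaE betaE; rewrite sk.
have t_stem := is_stem_take (ltn0Sn n) (stemP q).
have tn : size (take n.+1 (stem q)) = n.+1 by rewrite size_takel // ltnW.
have FHt : F (IdxS alpha) `<=`
    w _ (IdxS alpha) `&` large_side (good _ (IdxS alpha)) :=
  FH _ _ alpha t_stem (eq_leq tn).
(* If the good set is large, all successors allowed by [F] are good and the initial segment itself
   could force [psi], against [nk]. Otherwise [F] avoids the good set, so [beta] is bad. *)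
have := (FHt _ Fbeta).2; rewrite /large_side.
case: asboolP => [gt _|_ nbeta]; last first.
  by rewrite (take_nth (gamma 0%N)) // betaE.
case: nk; exists (Condition t_stem F_choice); first by [].
apply: (forces_of_successors (w := w) F_choice t_stem (alpha := alpha)) => //.
- by move=> u m a u_stem um x /(FH u m a u_stem um)[].
- by rewrite nth_take.
- by move=> b /FHt[_]; rewrite /large_side; case: asboolP.
Qed.

End TreePrikry.

Theorem theorem4p6 (d : Order.disp_t) (W : orderType d)
  (W_wf : well_founded (fun x y : W => x < y))
  (gamma : nat -> W) (gamma_sup : W)
  (gamma_card : forall n, infinite_cardinal (gamma n))
  (gamma_incr : forall m n : nat, (m < n)%N -> gamma m < gamma n)
  (gamma_supP : supremums (range gamma) gamma_sup)
  (D : forall x : idx gamma, set_system (below (gamma (level x))))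
  (D_ultra : forall x, UltraFilter (D x))
  (D_complete : forall x, complete_filter (gamma (level x)) (D x))
  (D_inj : forall n (alpha beta : below (gamma n)),
     alpha <> beta -> D (IdxS alpha) <> D (IdxS beta))
  (phi : sentence (condition D))
  (s : seq W) (s_stem : is_stem gamma s) :
  exists (F : forall x : idx gamma, set (below (gamma (level x))))
         (F_choice : choice_function D F),
    decides (@stronger d W gamma D) (Condition s_stem F_choice) phi.
Proof.
have [/can_force_condition|/can_force_or_forces_neg] :=
    pselect (can_force phi s).
- by move=> /(_ s_stem)[F [F_choice sF]]; exists F, F_choice; left.
- move=> /(_ gamma_card gamma_incr D_complete s_stem)[F [F_choice sF]].
  by exists F, F_choice; right.
Qed.
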